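(* Let $G$ be a $(P_3+P_1)$-free graph with at least one edge. Then $\mathsf{tree}\text{-}\alpha(G)=\mathsf{ibn}(G)$, unless $G$ is $C_4$-free but contains an induced $C_5$, in which case $\mathsf{tree}\text{-}\alpha(G)=2$.
   Context: All graphs are finite, simple and undirected. $P_n$ and $C_n$ denote the path and cycle on $n$ vertices; $P_3+P_1$ is the disjoint union of $P_3$ and $P_1$. A graph is $H$-free if it has no induced subgraph isomorphic to $H$. The induced biclique number $\mathsf{ibn}(G)$ is the largest nonnegative integer $s$ such that $G$ contains an induced subgraph isomorphic to $K_{s,s}$. A tree decomposition of $G$ is a pair $(T,\{X_t\}_{t\in V(T)})$ with $T$ a tree and bags $X_t\subseteq V(G)$ such that every vertex lies in some bag, every edge has both endpoints in some bag, and for each vertex $v$ the nodes whose bags contain $v$ induce a connected subtree. The tree-independence number $\mathsf{tree}\text{-}\alpha(G)$ is the minimum, over all tree decompositions, of $\max_t\alpha(G[X_t])$, where $\alpha$ denotes independence number. *)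

(* Defs.v *)
From mathcomp Require Import all_boot.
From mathcomp Require Import boolp.

Set Implicit Arguments.
Unset Strict Implicit.
Unset Printing Implicit Defensive.

Record sgraph := SGraph {
  vertex :> finType;
  edge : rel vertex;
  edge_sym : symmetric edge;
  edge_irrefl : irreflexive edge }.

Definition isomorphic (G H : sgraph) : Prop :=
  exists2 f : G -> H, bijective f & forall x y, edge (f x) (f y) = edge x y.

Section Induced.
Variables (G : sgraph) (A : {set G}).
Let V := {x : G | x \in A}.
Let e : rel V := fun x y => edge (val x) (val y).

Fact induced_sym : symmetric e.
Proof. by move=> x y; apply: edge_sym. Qed.

Fact induced_irrefl : irreflexive e.
Proof. by move=> x; apply: edge_irrefl. Qed.

Definition induced : sgraph := SGraph induced_sym induced_irrefl.
End Induced.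

Definition has_induced (G H : sgraph) : Prop :=
  exists A : {set G}, isomorphic (induced A) H.

Definition free (H G : sgraph) : Prop := ~ has_induced G H.

Section PathGraph.
Variable n : nat.
Let e : rel 'I_n := fun i j => (i.+1 == j) || (j.+1 == i).

Fact path_graph_sym : symmetric e.
Proof. by move=> i j; rewrite /e orbC. Qed.

Fact path_graph_irrefl : irreflexive e.
Proof. by move=> i; rewrite /e orbb eqn_leq ltnn. Qed.

Definition path_graph : sgraph := SGraph path_graph_sym path_graph_irrefl.
End PathGraph.

(* The n-cycle for n >= 3; [ordS] is the cyclic successor on ['I_n]. The
   condition [i != j] only matters for n = 1. *)
Section CycleGraph.
Variable n : nat.
Let e : rel 'I_n := fun i j => (i != j) && ((ordS i == j) || (ordS j == i)).

Fact cycle_graph_sym : symmetric e.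
Proof. by move=> i j; rewrite /e eq_sym orbC. Qed.

Fact cycle_graph_irrefl : irreflexive e.
Proof. by move=> i; rewrite /e eqxx. Qed.

Definition cycle_graph : sgraph := SGraph cycle_graph_sym cycle_graph_irrefl.
End CycleGraph.

Section DisjointUnion.
Variables G H : sgraph.
Let e : rel (G + H)%type := fun u v =>
  match u, v with
  | inl x, inl y => edge x y
  | inr x, inr y => edge x y
  | _, _ => false
  end.

Fact disjoint_union_sym : symmetric e.
Proof. by case=> x [] y //=; apply: edge_sym. Qed.

Fact disjoint_union_irrefl : irreflexive e.
Proof. by case=> x; apply: edge_irrefl. Qed.

Definition disjoint_union : sgraph :=
  SGraph disjoint_union_sym disjoint_union_irrefl.
End DisjointUnion.

Section Biclique.
Variables m n : nat.
Let e : rel ('I_m + 'I_n)%type := fun u v =>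
  match u, v with
  | inl _, inr _ | inr _, inl _ => true
  | _, _ => false
  end.

Fact biclique_sym : symmetric e.
Proof. by case=> x [] y. Qed.

Fact biclique_irrefl : irreflexive e.
Proof. by case. Qed.

Definition biclique : sgraph := SGraph biclique_sym biclique_irrefl.
End Biclique.

Definition independent (G : sgraph) (A : {set G}) : bool :=
  [forall x in A, forall y in A, ~~ edge x y].

Definition alpha (G : sgraph) : nat :=
  \max_(A : {set G} | independent A) #|A|.

Definition connected (G : sgraph) : Prop :=
  0 < #|G| /\ forall x y : G, connect (@edge G) x y.

(* [ucycle e c] is a duplicate-free closed walk; those of size at most 2
   (a vertex, or an edge walked back and forth) are not graph cycles. *)
Definition acyclic (G : sgraph) : Prop :=
  forall c : seq G, 2 < size c -> ~ ucycle (@edge G) c.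

Definition is_tree (T : sgraph) : Prop := connected T /\ acyclic T.

Record is_tree_decomposition (G T : sgraph) (X : T -> {set G}) : Prop := {
  td_tree : is_tree T;
  td_vertex : forall v : G, exists t, v \in X t;
  td_edge : forall u v : G, edge u v ->
    exists t, (u \in X t) && (v \in X t);
  td_connected : forall v : G, connected (induced [set t | v \in X t]) }.

Definition td_alpha (G T : sgraph) (X : T -> {set G}) : nat :=
  \max_(t : T) alpha (induced (X t)).

Definition has_td_alpha (G : sgraph) (k : nat) : Prop :=
  exists (T : sgraph) (X : T -> {set G}),
    is_tree_decomposition X /\ td_alpha X = k.

Lemma path_graph1_tree : is_tree (path_graph 1).
Proof.
split; first by split=> [|x y]; rewrite ?card_ord // [x]ord1 [y]ord1.
move=> c c_gt2 /andP[_ /card_uniqP c_card].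
have := max_card (mem c); rewrite c_card card_ord => c_le1.
by have := leq_trans c_gt2 c_le1.
Qed.

Lemma trivial_td (G : sgraph) :
  is_tree_decomposition (fun _ : path_graph 1 => [set: G]).
Proof.
split=> [|v|u v _|v]; first exact: path_graph1_tree.
- by exists ord0; rewrite inE.
- by exists ord0; rewrite !inE.
split.
  by apply/card_gt0P; eexists (exist _ ord0 _); rewrite // !inE.
by move=> x y; rewrite (_ : x = y) //; apply: val_inj; rewrite [LHS]ord1 [RHS]ord1.
Unshelve. by rewrite !inE.
Qed.

Lemma has_td_alpha_ex (G : sgraph) : exists k, `[< has_td_alpha G k >].
Proof.
exists (td_alpha (fun _ : path_graph 1 => [set: G])); apply/asboolP.
by exists (path_graph 1), (fun=> [set: G]); split=> //; apply: trivial_td.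
Qed.

Definition tree_alpha (G : sgraph) : nat := ex_minn (has_td_alpha_ex G).

Lemma biclique_ex (G : sgraph) :
  exists s, `[< has_induced G (biclique s s) >].
Proof.
exists 0; apply/asboolP; exists set0.
have F (x : induced (set0 : {set G})) : False.
  by case: x => x; rewrite inE.
exists (fun x => False_rect (biclique 0 0) (F x)); last by move=> x; case: (F x).
have F' (y : biclique 0 0) : False by case: y => [] [].
by exists (fun y => False_rect _ (F' y)) => z; [case: (F z) | case: (F' z)].
Qed.

Lemma biclique_bound (G : sgraph) (s : nat) :
  `[< has_induced G (biclique s s) >] -> s <= #|G|.
Proof.
case/asboolP=> A [f fbij _]; have := bij_eq_card fbij.
rewrite card_sum card_ord card_sig => eqA.
by rewrite (leq_trans (leq_addr s s)) // -eqA max_card.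
Qed.

Definition ibn (G : sgraph) : nat :=
  ex_maxn (biclique_ex G) (@biclique_bound G).

(* Main.v *)
Require Import Defs.
From mathcomp Require Import all_boot.
From mathcomp Require Import boolp zify.

Set Implicit Arguments.
Unset Strict Implicit.
Unset Printing Implicit Defensive.

(** Lower bounds: peeling off leaves of the tree shows that, for every nonempty
    vertex set S, some bag contains all neighbours in S of some vertex of S.
    Taking for S an induced K_{s,s} or C5 yields bags of independence number at
    least s, respectively 2.

    Upper bounds: if alpha(G) > 2, then a maximum independent set I displays G
    as the join of a disjoint union of |I| cliques and a graph G[J], and the
    bags "one clique together with J" have independence number at most ibn(G),
    since an independent subset of J spans a biclique with a subset of I. If
    alpha(G) <= 2, the single bag V(G) is good enough as soon as G has an
    induced C4 or C5; without these, V(G) splits into two cliques whose mutual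
    neighbourhoods are nested, and G has a path decomposition into cliques. *)

(** * Independent sets, induced subgraphs and the two invariants *)

Lemma independentP (G : sgraph) (A : {set G}) :
  reflect {in A &, forall x y, ~~ edge x y} (independent A).
Proof.
apply: (iffP forall_inP) => [indA x y xA yA | indA x xA].
  by have /forall_inP := indA x xA; apply.
by apply/forall_inP => y yA; apply: indA.
Qed.

Lemma edge_neq (G : sgraph) (x y : G) : edge x y -> x != y.
Proof. by apply: contraTneq => ->; rewrite edge_irrefl. Qed.

(** Embeddings are easier to write down than vertex subsets. Conversely, [h] corestricted to its
    image is injective between sets of equal size, hence bijective, and its inverse is the
    isomorphism. *)
Lemma has_inducedP (G H : sgraph) :
  has_induced G H <->
  exists2 h : H -> G, injective h & forall x y, edge (h x) (h y) = edge x y.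
Proof.
split=> [[A [f [g fK gK] fE]] | [h h_inj hE]].
  exists (fun x => val (g x)) => [x y /val_inj /(can_inj gK)//|x y].
  by rewrite -[RHS](congr2 (@edge H) (gK x) (gK y)) fE.
have hA x : h x \in h @: [set: H] by apply: imset_f.
pose g x : induced (h @: [set: H]) := exist _ (h x) (hA x).
have g_inj : injective g by move=> x y /(congr1 val)/h_inj.
have [f gK fK] : bijective g.
  apply: inj_card_bij => //.
  by rewrite card_sig (card_imset _ h_inj) cardsT.
exists (h @: [set: H]); exists f; first by exists g.
by move=> x y; rewrite -hE -[in RHS](fK x) -[in RHS](fK y).
Qed.

Lemma alpha_inducedP (G : sgraph) (B : {set G}) (k : nat) :
  reflect (forall A : {set G}, A \subset B -> independent A -> #|A| <= k)
          (alpha (induced B) <= k).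
Proof.
apply: (iffP (bigmax_leqP _ _ _)) => [le_k A sAB indA | le_k A indA].
  pose A' : {set induced B} := [set x | val x \in A].
  have <- : #|A'| = #|A|.
    rewrite -(card_imset _ val_inj); apply: eq_card => x.
    apply/imsetP/idP => [[y + ->]|xA]; first by rewrite inE.
    by exists (exist _ x (subsetP sAB x xA)); rewrite ?inE.
  apply: le_k; apply/independentP => x y; rewrite !inE => xA yA.
  by move/independentP: indA; apply.
rewrite -(card_imset _ val_inj); apply: le_k.
  by apply/subsetP => _ /imsetP[x _ ->]; apply: valP.
apply/independentP => _ _ /imsetP[x xA ->] /imsetP[y yA ->].
by move/independentP/(_ x y xA yA): indA.
Qed.

Lemma tree_alpha_le (G T : sgraph) (X : T -> {set G}) (k : nat) :
  is_tree_decomposition X ->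
  (forall t (A : {set G}), A \subset X t -> independent A -> #|A| <= k) ->
  tree_alpha G <= k.
Proof.
move=> tdX le_k; apply: (@leq_trans (td_alpha X)).
  rewrite /tree_alpha; case: ex_minnP => m _; apply.
  by apply/asboolP; exists T, X.
by apply/bigmax_leqP => t _; apply/alpha_inducedP; apply: le_k.
Qed.

Lemma tree_alpha_attained (G : sgraph) :
  exists (T : sgraph) (X : T -> {set G}), is_tree_decomposition X /\
    forall t (A : {set G}), A \subset X t -> independent A ->
      #|A| <= tree_alpha G.
Proof.
rewrite /tree_alpha; case: ex_minnP => m /asboolP[T [X [tdX <-]]] _.
exists T, X; split=> // t; apply/alpha_inducedP.
exact: (leq_bigmax_cond (F := fun t => alpha (induced (X t)))).
Qed.

Lemma ibn_ge (G : sgraph) (s : nat) :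
  has_induced G (biclique s s) -> s <= ibn G.
Proof.
by move=> hs; rewrite /ibn; case: ex_maxnP => m _; apply; apply/asboolP.
Qed.

Lemma ibn_attained (G : sgraph) : has_induced G (biclique (ibn G) (ibn G)).
Proof. by rewrite /ibn; case: ex_maxnP => m /asboolP. Qed.

(** The first [s] entries of the enumerations of [A] and [B] span the biclique. Disjointness is
    automatic: a common vertex would be adjacent to itself. *)
Lemma ibn_ge_complete_pair (G : sgraph) (A B : {set G}) (s : nat) :
  independent A -> independent B -> {in A & B, forall x y, edge x y} ->
  s <= #|A| -> s <= #|B| -> s <= ibn G.
Proof.
case: s => // s /independentP indA /independentP indB AB sA sB.
apply/ibn_ge/has_inducedP.
have [x0 _] : exists x, x \in A by apply/card_gt0P; lia.
pose h (u : biclique s.+1 s.+1) := match u with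
  | inl i => nth x0 (enum A) i | inr i => nth x0 (enum B) i end.
have hA (i : 'I_s.+1) : nth x0 (enum A) i \in A.
  by rewrite -mem_enum mem_nth // -cardE (leq_trans _ sA).
have hB (i : 'I_s.+1) : nth x0 (enum B) i \in B.
  by rewrite -mem_enum mem_nth // -cardE (leq_trans _ sB).
have hE x y : edge (h x) (h y) = edge x y.
  case: x y => i [] j /=; [exact/negbTE/indA | exact: AB | | exact/negbTE/indB].
  by rewrite edge_sym AB.
exists h => // -[] i [] j /= eq_h.
- congr inl; apply/val_inj/eqP.
  have ltA (k : 'I_s.+1) : k < size (enum A) by rewrite -cardE (leq_trans _ sA).
  by rewrite -(nth_uniq x0 (ltA i) (ltA j) (enum_uniq _)) eq_h.
- by have /edge_neq := AB _ _ (hA i) (hB j); rewrite eq_h eqxx.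
- by have /edge_neq := AB _ _ (hA j) (hB i); rewrite eq_h eqxx.
- congr inr; apply/val_inj/eqP.
  have ltB (k : 'I_s.+1) : k < size (enum B) by rewrite -cardE (leq_trans _ sB).
  by rewrite -(nth_uniq x0 (ltB i) (ltB j) (enum_uniq _)) eq_h.
Qed.

Lemma ibn_gt0 (G : sgraph) (x y : G) : edge x y -> 0 < ibn G.
Proof.
move=> xy; have ind1 z : independent [set z : G].
  by apply/independentP => u v /set1P-> /set1P->; rewrite edge_irrefl.
apply: (@ibn_ge_complete_pair _ [set x] [set y]); rewrite ?cards1 //.
by move=> u v /set1P-> /set1P->.
Qed.

(** * Recognising the forbidden induced subgraphs *)

Lemma P3P1_free_path (G : sgraph) (a b c d : G) :
  free (disjoint_union (path_graph 3) (path_graph 1)) G ->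
  a != c -> edge a b -> edge b c -> ~~ edge a c ->
  ~~ edge a d -> ~~ edge b d -> ~~ edge c d -> False.
Proof.
move=> + ac ab bc nac nad nbd ncd; apply; apply/has_inducedP.
(* Each of [a], [b], [c] has a neighbour on the path, whereas [d] has none. *)
have ad : a != d by apply: contraNneq nbd => <-; rewrite edge_sym.
have bd : b != d by apply: contraNneq nad => <-.
have cd : c != d by apply: contraNneq nbd => <-.
exists (fun u => match u with
  | inl i => nth a [:: a; b; c] (nat_of_ord i) | inr _ => d end).
{ move=> [[[|[|[|i]]] hi]|i] [[[|[|[|j]]] hj]|j] //= eq_h.
  all: try by [congr inl; apply: val_inj | congr inr; rewrite (ord1 i) (ord1 j)].
  all: move: (edge_neq ab) (edge_neq bc) ac ad bd cd.
  all: by rewrite eq_h eqxx. }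
{ move=> [[[|[|[|i]]] hi]|i] [[[|[|[|j]]] hj]|j] //=; rewrite ?edge_irrefl //.
  all: try by [apply/negbTE | rewrite edge_sym; apply/negbTE | rewrite edge_sym].
  by rewrite (ord1 i) (ord1 j). }
Qed.

Lemma has_induced_C4 (G : sgraph) (a b c d : G) :
  edge a b -> edge b c -> edge c d -> edge d a -> a != c -> b != d ->
  ~~ edge a c -> ~~ edge b d -> has_induced G (cycle_graph 4).
Proof.
move=> ab bc cd da ac bd nac nbd; apply/has_inducedP.
exists (fun i : 'I_4 => nth a [:: a; b; c; d] i).
{ move=> [[|[|[|[|i]]]] hi] [[|[|[|[|j]]]] hj] //= eq_h; try exact: val_inj.
  all: move: (edge_neq ab) (edge_neq bc) (edge_neq cd) (edge_neq da) ac bd.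
  all: by rewrite eq_h eqxx. }
{ move=> [[|[|[|[|i]]]] hi] [[|[|[|[|j]]]] hj] //=; rewrite -?val_eqE /= ?edge_irrefl //.
  all: try by [apply/negbTE | rewrite edge_sym; apply/negbTE | rewrite edge_sym]. }
Qed.

Lemma has_induced_C5 (G : sgraph) (a b c d e : G) :
  edge a b -> edge b c -> edge c d -> edge d e -> edge e a ->
  ~~ edge a c -> ~~ edge b d -> ~~ edge c e -> ~~ edge d a -> ~~ edge e b ->
  has_induced G (cycle_graph 5).
Proof.
move=> ab bc cd de ea nac nbd nce nda neb; apply/has_inducedP.
(* Two non-consecutive vertices are told apart by a third one, adjacent to exactly one of them. *)
have ac : a != c by apply: contraNneq nda => ->; rewrite edge_sym.
have bd : b != d by apply: contraNneq neb => ->; rewrite edge_sym.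
have ce : c != e by apply: contraNneq nac => ->; rewrite edge_sym.
have da : d != a by apply: contraNneq nbd => ->; rewrite edge_sym.
have eb : e != b by apply: contraNneq nce => ->; rewrite edge_sym.
exists (fun i : 'I_5 => nth a [:: a; b; c; d; e] i).
{ move=> [[|[|[|[|[|i]]]]] hi] [[|[|[|[|[|j]]]]] hj] //= eq_h; try exact: val_inj.
  all: move: (edge_neq ab) (edge_neq bc) (edge_neq cd) (edge_neq de) (edge_neq ea).
  all: by move: ac bd ce da eb; rewrite eq_h eqxx. }
{ move=> [[|[|[|[|[|i]]]]] hi] [[|[|[|[|[|j]]]]] hj] //=; rewrite -?val_eqE /= ?edge_irrefl //.
  all: try by [apply/negbTE | rewrite edge_sym; apply/negbTE | rewrite edge_sym]. }
Qed.

(** * Leaves of trees and their removal *)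

(* Otherwise a longest path inside [W] could be closed into a cycle at its
   first vertex. *)
Lemma acyclic_leaf (T : sgraph) (W : {set T}) :
  acyclic T -> W != set0 ->
  exists2 t, t \in W &
    {in W &, forall r s, edge t r -> edge t s -> r = s}.
Proof.
move=> acT /set0Pn[w wW]; apply: contrapT => no_leaf.
have deg2 t u : t \in W -> exists2 r, r \in W & edge t r && (r != u).
  move=> tW; apply: contrapT => no_r; apply: no_leaf; exists t => // r s rW sW tr ts.
  have eq_u x : x \in W -> edge t x -> x = u.
    move=> xW tx; apply/eqP; apply: contra_notT no_r => xu.
    by exists x; rewrite ?tx.
  by rewrite (eq_u r) // (eq_u s).
have long n : exists x p, [/\ path (@edge T) x p, uniq (x :: p),
    {subset x :: p <= W} & size p = n].
  elim: n => [|n [x [p [xp uxp sxp <-]]]].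
    by exists w, [::]; split=> // x; rewrite inE => /eqP->.
  (* The path grows at its front and avoids stepping back to the second vertex [head x p]. Hence a
     repeated vertex [r] closes a cycle of length at least 3. *)
  have [r rW /andP[xr rp]] := deg2 x (head x p) (sxp x (mem_head x p)).
  have rx : r != x by rewrite eq_sym edge_neq.
  have [r_p|r_p] := boolP (r \in p); last first.
    exists r, (x :: p); split=> //=.
    - by rewrite edge_sym xr.
    - by rewrite inE (negbTE rx) r_p.
    - by move=> y; rewrite inE => /predU1P[->//|]; apply: sxp.
  case/splitPr: r_p xp uxp rp {sxp} => p1 p2 xp uxp rp.
  case: (acT (x :: rcons p1 r)).
    by case: p1 rp {xp uxp} => [|y p1]; rewrite /= ?eqxx // size_rcons.
  move: xp uxp; rewrite -cat_rcons cat_path -cat_cons cat_uniq.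
  case/andP=> xp _ /andP[uxp _]; rewrite /ucycle uxp andbT /=.
  by rewrite rcons_path xp last_rcons edge_sym.
(* A duplicate-free path with [#|T|] edges would have [#|T| + 1] vertices. *)
have [x [p [_ /card_uniqP cxp _ sp]]] := long #|T|.
by have := max_card (mem (x :: p)); rewrite cxp /= sp ltnn.
Qed.

(** Restricting the relation rather than the graph keeps the vertex type fixed while the node set
    shrinks. *)
Definition edge_in (T : sgraph) (C : {set T}) : rel T :=
  [rel r s | [&& edge r s, r \in C & s \in C]].

Lemma induced_connected (T : sgraph) (C : {set T}) :
  connected (induced C) -> {in C &, forall r s, connect (edge_in C) r s}.
Proof.
case=> _ conC r s rC sC.
have /connectP[p] := conC (exist _ r rC) (exist _ s sC).
elim: p r rC => [|q p IHp] r rC /= => [_ /(congr1 val) /= <-//|].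
case: q => q qC /andP[rq qp] eq_s.
apply: (connect_trans (connect1 _)) (IHp q qC qp eq_s).
by rewrite /edge_in /= rC qC !andbT; apply: rq.
Qed.

(** A walk that enters [t] must leave it through the same neighbour, so its visits to [t] can be cut
    out. *)
Lemma edge_in_remove_leaf (T : sgraph) (C : {set T}) (t r s : T) :
  {in C &, forall r s, edge t r -> edge t s -> r = s} ->
  r != t -> s != t -> connect (edge_in C) r s ->
  connect (edge_in (C :\ t)) r s.
Proof.
move=> leaf rt st /connectP[p].
(* A walk starting at [t] has no counterpart in [C :\ t]; the second claim lets it start at a
   neighbour of [t] instead. *)
have H : forall r, path (edge_in C) r p -> s = last r p ->
   (r != t -> connect (edge_in (C :\ t)) r s) /\
   (r = t -> forall w, w \in C -> edge t w -> connect (edge_in (C :\ t)) w s).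
  elim: p => [|q p IHp] {rt}r /= => [_ eq_s|/andP[/and3P[rq rC qC] qp] eq_s].
    by split=> [|rt]; [rewrite eq_s | rewrite eq_s rt eqxx in st].
  have [IH1 IH2] := IHp q qp eq_s; split=> [rt|rt w wC tw].
    have [qt|qt] := eqVneq q t.
      by apply: IH2 => //; rewrite -qt edge_sym.
    apply: connect_trans (connect1 _) (IH1 qt).
    by rewrite /edge_in /= rq !inE rt qt rC.
  rewrite rt in rq.
  by rewrite -(leaf q w) //; apply: IH1; rewrite eq_sym edge_neq.
by move=> rp eq_s; have [+ _] := H r rp eq_s; apply.
Qed.

(* Peel off leaves of the tree: either some vertex occurs only in the leaf
   bag, which then contains all its neighbours, or the leaf is redundant. *)
Lemma forest_bag_neighbourhood (G T : sgraph) (X : T -> {set G}) (S : {set G})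
    (W : {set T}) :
  acyclic T -> S != set0 ->
  {in S, forall v, exists2 t, t \in W & v \in X t} ->
  {in S &, forall u v, edge u v ->
     exists2 t, t \in W & (u \in X t) && (v \in X t)} ->
  {in S, forall v, {in [set t in W | v \in X t] &, forall r s,
     connect (edge_in [set t in W | v \in X t]) r s}} ->
  exists2 v, v \in S & exists t, {in S, forall u, edge v u -> u \in X t}.
Proof.
move=> acT /set0Pn[v0 v0S]; have [n] := ubnP #|W|.
elim: n W => // n IHn W cardW vW eW conW.
have [t tW leaf] : exists2 t, t \in W &
    {in W &, forall r s, edge t r -> edge t s -> r = s}.
  apply: acyclic_leaf => //; have [t tW _] := vW v0 v0S.
  by apply/set0Pn; exists t.
have [[v vS only_t]|not_only] := pselect (exists2 v, v \in S &
    {in W, forall r, v \in X r -> r = t}).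
  exists v => //; exists t => u uS vu.
  by have [r rW /andP[vr ur]] := eW v u vS uS vu; rewrite -(only_t r rW vr).
have other v : v \in S -> exists2 r, r \in W :\ t & v \in X r.
  move=> vS; apply: contrapT => no_r; apply: not_only; exists v => // r rW vr.
  apply/eqP; apply: contra_notT no_r => rt.
  by exists r; rewrite // !inE rt.
(* A vertex of the leaf bag that occurs elsewhere also occurs in a bag adjacent to the leaf: take
   the first step of a walk among its nodes. *)
have next v : v \in S -> v \in X t ->
    exists2 r, r \in W & edge t r && (v \in X r).
  move=> vS vt; have [r] := other v vS; rewrite !inE => /andP[rt rW] vr.
  have /connectP[[|q p]] : connect (edge_in [set t in W | v \in X t]) t r.
    by apply: conW; rewrite ?inE ?tW ?rW.
  - by move=> _ rt'; rewrite rt' eqxx in rt.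
  - case/andP=> /and3P[tq _]; rewrite inE => /andP[qW vq] _ _.
    by exists q; rewrite ?tq.
have setE v : [set r in W :\ t | v \in X r] = [set r in W | v \in X r] :\ t.
  by apply/setP => r; rewrite !inE andbA.
apply: (IHn (W :\ t)) => //.
- by move: cardW; rewrite (cardsD1 t) tW.
- move=> u v uS vS uv; have [r rW /andP[ur vr]] := eW u v uS vS uv.
  have [rt|rt] := eqVneq r t; last by exists r; rewrite ?inE ?rt ?ur.
  rewrite rt in ur vr.
  (* Both endpoints survive in the bag of the unique neighbour of the leaf, which therefore takes
     over the edge. *)
  have [q qW /andP[tq uq]] := next u uS ur.
  have [q' q'W /andP[tq' vq]] := next v vS vr.
  have eq_q := leaf q q' qW q'W tq tq'.
  by exists q; rewrite ?inE ?qW ?uq ?eq_q ?vq ?andbT // eq_sym edge_neq.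
- move=> v vS r s; rewrite setE !in_setD1 => /andP[rt rC] /andP[st sC].
  apply: edge_in_remove_leaf => //; last exact: conW.
  by move=> x y; rewrite !inE => /andP[xW _] /andP[yW _]; apply: leaf.
Qed.

(** * Lower bounds on the tree-independence number *)

(** In an optimal decomposition, some bag contains the whole neighbourhood within [S] of some [v],
    hence the set [A] belonging to that [v]. *)
Lemma tree_alpha_ge (G : sgraph) (S : {set G}) (k : nat) :
  S != set0 ->
  {in S, forall v, exists2 A : {set G}, A \subset S &
     [/\ independent A, k <= #|A| & {in A, forall u, edge v u}]} ->
  k <= tree_alpha G.
Proof.
move=> S0 nbS; have [T [X [tdX leX]]] := tree_alpha_attained G.
case: tdX => [[_ acT] vX eX conX].
have [|||v vS [t tP]] := @forest_bag_neighbourhood G T X S setT acT S0.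
- by move=> v _; have [t vt] := vX v; exists t.
- by move=> u v _ _ /eX[t uvt]; exists t.
- move=> v _; have -> : [set t in setT | v \in X t] = [set t | v \in X t].
    by apply/setP => t; rewrite !inE.
  exact/induced_connected.
have [A sAS [indA kA vA]] := nbS v vS.
apply: leq_trans kA (leX t A _ indA).
by apply/subsetP => u uA; apply: tP; rewrite ?vA // (subsetP sAS).
Qed.

(** In a biclique, the neighbourhood of a vertex is the opposite side. *)
Lemma tree_alpha_ge_ibn (G : sgraph) : ibn G <= tree_alpha G.
Proof.
have /has_inducedP := ibn_attained G; case: (ibn G) => // s [h h_inj hE].
apply: (@tree_alpha_ge _ (h @: setT)).
  by apply/set0Pn; exists (h (inl ord0)); apply: imset_f.
have side (g : 'I_s.+1 -> biclique s.+1 s.+1) : injective g ->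
    (forall i j, edge (g i) (g j) = false) ->
    [/\ (h \o g) @: setT \subset h @: setT, independent ((h \o g) @: setT)
       & s < #|(h \o g) @: setT|].
  move=> g_inj gE; split.
  - by apply/subsetP => _ /imsetP[i _ ->]; apply: imset_f.
  - by apply/independentP => _ _ /imsetP[i _ ->] /imsetP[j _ ->]; rewrite hE gE.
  - by rewrite card_imset ?cardsT ?card_ord //; apply: inj_comp.
move=> _ /imsetP[[i|i] _ ->].
- have [||sub ind card] := side inr => [? ? []||] //.
  by exists ((h \o inr) @: setT) => //; split=> // _ /imsetP[j _ ->]; rewrite hE.
- have [||sub ind card] := side inl => [? ? []||] //.
  by exists ((h \o inl) @: setT) => //; split=> // _ /imsetP[j _ ->]; rewrite hE.
Qed.

(** The two neighbours of a vertex of $C_5$ are distinct and non-adjacent. *)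
Lemma tree_alpha_ge_C5 (G : sgraph) :
  has_induced G (cycle_graph 5) -> 2 <= tree_alpha G.
Proof.
case/has_inducedP=> h h_inj hE; apply: (@tree_alpha_ge _ (h @: setT)).
  by apply/set0Pn; exists (h ord0); apply: imset_f.
move=> _ /imsetP[i _ ->]; pose A : {set 'I_5} := [set ordS i; ord_pred i].
exists (h @: A); first exact/imsetS/subsetT.
split.
- apply/independentP => _ _ /imsetP[j jA ->] /imsetP[k kA ->]; rewrite hE.
  move: jA kA; rewrite !inE => /orP[] /eqP-> /orP[] /eqP->; rewrite ?edge_irrefl //.
    by case: i @A => [[|[|[|[|[|i]]]]] hi].
  by case: i @A => [[|[|[|[|[|i]]]]] hi].
- rewrite card_imset // cards2 -val_eqE /=.
  by case: i @A => [[|[|[|[|[|i]]]]] hi].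
- move=> _ /imsetP[j jA ->]; rewrite hE; move: jA; rewrite !inE => /orP[] /eqP->.
    by case: i @A => [[|[|[|[|[|i]]]]] hi].
  by case: i @A => [[|[|[|[|[|i]]]]] hi].
Qed.

(** * Path decompositions *)

(** The largest vertex [m] of a cycle would need two distinct smaller neighbours, but only [m - 1]
    is available. *)
Lemma path_graph_acyclic (n : nat) : acyclic (path_graph n).
Proof.
move=> c c_gt2 /andP[cyc_c uniq_c].
have [m mc maxm] : exists2 m : 'I_n, m \in c & {in c, forall i : 'I_n, i <= m}.
  case: c c_gt2 {cyc_c uniq_c} => // i0 c _.
  case: (@arg_maxnP _ i0 (mem (i0 :: c)) (@nat_of_ord n)) => [|m]; first exact: mem_head.
  by exists m.
have [k q rot_c] := rot_to mc.
have sub_q i : i \in q -> i <= m.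
  by move=> iq; apply: maxm; rewrite -(mem_rot k) rot_c inE iq orbT.
have size_q : 1 < size q by have := c_gt2; rewrite -(size_rot k) rot_c.
rewrite -(rot_uniq k) rot_c in uniq_c; rewrite -(rot_cycle k) rot_c in cyc_c.
case: q {rot_c} sub_q size_q uniq_c cyc_c => [|a [|b q]] //= sub_q _.
case/and3P=> _ aq _; rewrite rcons_path => /and4P[ma _ _ lm].
have la : last b q = a.
  apply: val_inj => /=; have := sub_q a; have := sub_q (last b q).
  rewrite !inE eqxx -in_cons mem_last orbT => /(_ isT) + /(_ isT).
  by move: ma lm => /=; lia.
by case/negP: aq; rewrite -la mem_last.
Qed.

(** On a path, connectedness of the nodes of [v] amounts to their forming a nonempty interval. *)
Lemma path_decomposition (G : sgraph) (n : nat)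
    (X : path_graph n.+1 -> {set G}) :
  (forall v, exists t, v \in X t) ->
  (forall u v, edge u v -> exists t, (u \in X t) && (v \in X t)) ->
  (forall v (i j k : 'I_n.+1), i <= j <= k -> v \in X i -> v \in X k -> v \in X j) ->
  is_tree_decomposition X.
Proof.
move=> vX eX convX; split=> //.
  split; last exact: path_graph_acyclic.
  split; first by rewrite card_ord.
  suff con0 (x : path_graph n.+1) : connect (@edge (path_graph n.+1)) ord0 x.
    move=> x y; apply: connect_trans (con0 y); rewrite (sym_connect_sym (@edge_sym _)).
    exact: con0.
  case: x; elim=> [|m IHm] hm; first by rewrite (_ : Ordinal hm = ord0) //; apply: val_inj.
  apply: connect_trans (IHm (ltnW hm)) (connect1 _).
  by rewrite /= eqxx.
move=> v; split.
  have [t vt] := vX v; have tV : t \in [set t | v \in X t] by rewrite inE.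
  by apply/card_gt0P; exists (exist _ t tV).
set I := induced _.
(* Induction on the distance [m] of the two nodes; the node just before the upper one lies in the
   set by convexity. *)
suff con_le m : forall x y : I, val y = val x + m :> nat -> connect (@edge I) x y.
  move=> x y; case: (leqP (val x) (val y)) => xy.
    by apply: (con_le (val y - val x)); rewrite subnKC.
  rewrite (sym_connect_sym (@edge_sym _)).
  by apply: (con_le (val x - val y)); rewrite subnKC // ltnW.
elim: m => [|m IHm] x y eq_y.
  by rewrite (_ : x = y) //; do 2!apply: val_inj; rewrite addn0 in eq_y.
have hz : val x + m < n.+1 by have := ltn_ord (val y); lia.
have zX : Ordinal hz \in [set t | v \in X t].
  rewrite inE; have := valP x; have := valP y; rewrite !inE => vy vx.
  by apply: (convX v (val x) _ (val y)) => //=; rewrite leq_addr /= eq_y leq_add2l.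
pose z : I := exist _ (Ordinal hz) zX.
have xz : connect (@edge I) x z by apply: IHm.
apply: connect_trans xz (connect1 _).
by apply/orP; left; rewrite /= eq_y addnS.
Qed.

(** * Graphs with independence number at most two *)

Definition clique (G : sgraph) (A : {set G}) : Prop :=
  {in A &, forall x y, x != y -> edge x y}.

Lemma clique_independent_card (G : sgraph) (B A : {set G}) :
  clique B -> A \subset B -> independent A -> #|A| <= 1.
Proof.
move=> clB /subsetP sAB /independentP indA.
apply/card_le1P => x xA y; rewrite inE; apply/idP/eqP => [yA|->//].
apply/eqP; apply: contraTT (indA y x yA xA) => yx.
by rewrite negbK clB ?sAB.
Qed.

(* The neighbourhoods in [~: A] of the vertices of [A] form a chain; sweeping
   along it replaces the vertices of [A] one after the other by those of
   [~: A]. *)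
Lemma cobipartite_tree_alpha (G : sgraph) (A : {set G}) :
  free (cycle_graph 4) G -> clique A -> clique (~: A) -> tree_alpha G <= 1.
Proof.
move=> noC4 clA clB.
pose N a : {set G} := [set b in ~: A | edge a b].
pose d a := #|N a|.
have leN a : d a <= #|G| by apply: max_card.
(* Otherwise, by the comparison of degrees, some [b'] is adjacent to [a'] but not to [a], and [a],
   [a'], [b'], [b] form an induced $C_4$. *)
have nested a a' b : a \in A -> a' \in A -> d a <= d a' -> b \notin A ->
    edge a b -> edge a' b.
  move=> aA a'A le_d bA ab; apply: contraT => na'b.
  have [b' b'N nb'] : exists2 b', b' \in N a' & b' \notin N a.
    apply/subsetPn; apply/negP => sub; have : N a' \proper N a.
      by apply/properP; split=> //; exists b; rewrite !inE ?bA ?ab ?(negbTE na'b) ?andbF.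
    by move/proper_card; rewrite ltnNge; move: le_d; rewrite /d => ->.
  move: b'N nb'; rewrite !inE => /andP[b'A a'b']; rewrite b'A /= => nab'.
  case: noC4; apply: (@has_induced_C4 _ a a' b' b) => //.
  - by apply: clA => //; apply: contraNneq nab' => ->.
  - by apply: clB; rewrite ?inE //; apply: contraNneq nab' => ->.
  - by rewrite edge_sym.
  - by apply: contraNneq b'A => <-.
  - by apply: contraNneq bA => <-.
(* A vertex of [A] leaves after time [d v]; any other vertex enters with its first neighbour in [A]
   to leave. The last node [#|G| + 1] exceeds every [d v], so its bag is exactly [~: A], which also
   covers vertices without neighbours in [A]. *)
pose X (t : path_graph #|G|.+2) : {set G} := [set v | if v \in A then t <= d v
  else (t == #|G|.+1 :> nat) || [exists a in A, edge a v && (d a <= t)]].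
have tdX : is_tree_decomposition X.
  apply: path_decomposition.
  - move=> v; have [vA|vA] := boolP (v \in A).
      by exists ord0; rewrite inE vA.
    by exists ord_max; rewrite inE (negbTE vA) eqxx.
  - have mixed u v : u \in A -> v \notin A -> edge u v ->
        exists t, (u \in X t) && (v \in X t).
      move=> uA vA uv.
      have hu : d u < #|G|.+2 by rewrite ltnS leqW.
      exists (Ordinal hu); rewrite !inE uA (negbTE vA) /= leqnn /=.
      by apply/orP; right; apply/exists_inP; exists u; rewrite ?uv /=.
    move=> u v uv; have [uA|uA] := boolP (u \in A); have [vA|vA] := boolP (v \in A).
    + by exists ord0; rewrite !inE uA vA.
    + exact: mixed.
    + have [|t] := mixed v u vA uA; first by rewrite edge_sym.
      by rewrite andbC; exists t.
    + by exists ord_max; rewrite !inE (negbTE uA) (negbTE vA) eqxx.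
  - move=> v i j k /andP[ij jk]; rewrite !inE; case: ifP => vA.
      by move=> _; apply: leq_trans.
    case/orP=> [/eqP i_max _|/exists_inP[a aA /andP[av ai]] _].
      apply/orP; left; rewrite eqn_leq -ltnS ltn_ord /=.
      by apply: leq_trans ij; rewrite i_max.
    apply/orP; right; apply/exists_inP; exists a => //.
    by rewrite av (leq_trans ai).
apply: (tree_alpha_le tdX) => t S; apply: clique_independent_card.
(* If [v] entered through [a], then [d a <= t <= d u], so nestedness passes the edge from [a] to
   [u]. *)
have mixed u v : u \in X t -> v \in X t -> u \in A -> v \notin A -> edge u v.
  rewrite !inE => + + uA vA; rewrite uA (negbTE vA) => tu.
  case/orP=> [/eqP t_max|/exists_inP[a aA /andP[av at_]]].
    by have := leN u; lia.
  by apply: (nested a) => //; apply: leq_trans tu.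
move=> u v uX vX uv.
have [uA|uA] := boolP (u \in A); have [vA|vA] := boolP (v \in A).
- exact: clA.
- exact: mixed.
- by rewrite edge_sym mixed.
- by apply: clB; rewrite ?inE.
Qed.

Lemma independent_triple (G : sgraph) (x y z : G) :
  (forall A : {set G}, independent A -> #|A| <= 2) ->
  x != y -> x != z -> y != z ->
  ~~ edge x y -> ~~ edge x z -> ~~ edge y z -> False.
Proof.
move=> alpha2 xy xz yz nxy nxz nyz.
have /alpha2 : independent [set x; y; z].
  apply/independentP => u v; rewrite !inE -!orbA.
  by case/or3P=> /eqP-> /or3P[] /eqP->; rewrite ?edge_irrefl // edge_sym.
by rewrite setUC cardsU1 cards2 !inE negb_or eq_sym xz eq_sym yz xy.
Qed.

(** Such a graph is chordal, since longer induced cycles contain three independent vertices.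
    Non-adjacent [x] and [y] yield cliques [A0] and [B0] of non-neighbours of [y] and of [x]; the
    remaining vertices form a clique and are distributed among the two. *)
Lemma alpha2_chordal_tree_alpha (G : sgraph) :
  (forall A : {set G}, independent A -> #|A| <= 2) ->
  free (cycle_graph 4) G -> free (cycle_graph 5) G -> tree_alpha G <= 1.
Proof.
move=> alpha2 noC4 noC5.
have [complete|] := pselect (clique [set: G]).
  apply: (tree_alpha_le (trivial_td G)) => _ A.
  exact: clique_independent_card.
move=> not_complete.
have [x [y [xy nxy]]] : exists x y : G, x != y /\ ~~ edge x y.
  apply: contrapT => no_xy; apply: not_complete => x y _ _ xy.
  by apply: contra_notT no_xy => nxy; exists x, y.
pose A0 : {set G} := [set v | (v != y) && ~~ edge y v].
pose B0 : {set G} := [set v | (v != x) && ~~ edge x v].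
have xA0 : x \in A0 by rewrite inE xy edge_sym.
have yB0 : y \in B0 by rewrite inE eq_sym xy.
have clA0 : clique A0.
  move=> u v; rewrite !inE => /andP[uy nyu] /andP[vy nyv] uv.
  apply: contraT => nuv; exfalso.
  by apply: (@independent_triple G y u v); rewrite // eq_sym.
have clB0 : clique B0.
  move=> u v; rewrite !inE => /andP[ux nxu] /andP[vx nxv] uv.
  apply: contraT => nuv; exfalso.
  by apply: (@independent_triple G x u v); rewrite // eq_sym.
have disj v : v \in A0 -> v \in B0 -> False.
  rewrite !inE => /andP[vy nyv] /andP[vx nxv].
  by apply: (@independent_triple G x y v); rewrite // eq_sym.
have restE v : v \notin A0 -> v \notin B0 -> edge x v && edge y v.
  rewrite !inE !negb_and !negbK => /orP[/eqP->|yv] /orP[/eqP eq_x|xv].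
  - by rewrite eq_x eqxx in xy.
  - by rewrite (negbTE nxy) in xv.
  - by rewrite eq_x edge_sym (negbTE nxy) in yv.
  - by rewrite xv.
have clM : clique (~: (A0 :|: B0)).
  move=> u v; rewrite !in_setC !in_setU !negb_or => /andP[uA uB] /andP[vA vB] uv.
  have /andP[xu yu] := restE u uA uB; have /andP[xv yv] := restE v vA vB.
  apply: contraT => nuv; case: noC4.
  (* Two non-adjacent common neighbours of [x] and [y] would close a 4-cycle. *)
  by apply: (@has_induced_C4 _ x u y v) => //; rewrite edge_sym.
(* Outside [A0] and [B0] a vertex is complete to one of them: non-neighbours
   on both sides would give an induced C5. *)
pose A := A0 :|: [set m | (m \notin B0) && [forall a in A0, edge a m]].
have complA m a : m \in A -> m \notin A0 -> a \in A0 -> edge a m /\ m \notin B0.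
  rewrite in_setU inE => /orP[->//|/andP[mB /forall_inP mA]] _ aA0.
  by split=> //; apply: mA.
have complB m b : m \notin A -> m \notin B0 -> b \in B0 -> edge b m.
  rewrite in_setU inE negb_or => /andP[mA0] + mB0 bB0; rewrite mB0 /=.
  rewrite negb_forall_in => /exists_inP[a aA0 nam].
  have /andP[xm ym] := restE m mA0 mB0.
  apply: contraT => nbm.
  have ab : a != b by apply: contraTneq bB0 => <-; apply/negP => /(disj a aA0).
  have am : a != m by apply: contraNneq mA0 => <-.
  have bm : b != m by apply: contraNneq mB0 => <-.
  (* Neither [a] nor [b] is adjacent to [m], so they are adjacent to each other, and [x], [a], [b],
     [y], [m] is the induced 5-cycle. *)
  have eab : edge a b.
    by apply: contraT => nab; exfalso; apply: (@independent_triple G a b m).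
  have xa : edge x a by apply: clA0 => //; apply: contraNneq nam => <-.
  have byE : edge b y by apply: clB0 => //; apply: contraNneq nbm => ->.
  move: aA0 bB0; rewrite !inE => /andP[ay nya] /andP[bx nxb].
  case: noC5; apply: (@has_induced_C5 _ x a b y m) => //.
  - by rewrite edge_sym.
  - by rewrite edge_sym.
  - by rewrite edge_sym.
  - by rewrite edge_sym.
apply: (@cobipartite_tree_alpha G A) => // u v.
- move=> uA vA uv.
  have [uA0|uA0] := boolP (u \in A0); have [vA0|vA0] := boolP (v \in A0).
  + exact: clA0.
  + by have [] := complA v u vA vA0 uA0.
  + by rewrite edge_sym; have [] := complA u v uA uA0 vA0.
  + have [_ uB0] := complA u x uA uA0 xA0; have [_ vB0] := complA v x vA vA0 xA0.
    by apply: clM; rewrite // in_setC in_setU negb_or ?uA0 ?vA0.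
- rewrite !in_setC => uA vA uv.
  have notA0 w : w \notin A -> w \notin A0 by rewrite in_setU negb_or => /andP[].
  have [uB0|uB0] := boolP (u \in B0); have [vB0|vB0] := boolP (v \in B0).
  + exact: clB0.
  + exact: complB.
  + by rewrite edge_sym complB.
  + by apply: clM; rewrite // in_setC in_setU negb_or notA0.
Qed.

(** * Graphs with independence number at least three *)

Lemma alpha3_tree_alpha (G : sgraph) (I : {set G}) :
  free (disjoint_union (path_graph 3) (path_graph 1)) G ->
  (exists x y : G, edge x y) ->
  independent I -> (forall A : {set G}, independent A -> #|A| <= #|I|) ->
  2 < #|I| -> tree_alpha G <= ibn G.
Proof.
move=> noP [x0 [y0 xy0]] indI maxI I3; have indIP := independentP _ indI.
(* The third element of [I] will serve as the isolated vertex or as an end of the path in a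
   forbidden $P_3+P_1$. *)
have other i j : exists2 k, k \in I & (k != i) && (k != j).
  have : 0 < #|I :\ i :\ j|.
    by have := cardsD1 i I; have := cardsD1 j (I :\ i); lia.
  by case/card_gt0P=> k; rewrite !inE => /and3P[kj ki kI]; exists k; rewrite ?ki.
pose J : {set G} := [set v | [forall i in I, edge v i]].
have JP v i : v \in J -> i \in I -> edge v i.
  by rewrite inE => /forall_inP; apply.
pose N (v i : G) := (v == i) || edge v i.
(* Two neighbours [i], [j] of [v] in [I] together with a non-neighbour [k] in [I] give the path [i],
   [v], [j] and the isolated [k]. *)
have N_inj v i j : v \notin J -> i \in I -> j \in I -> N v i -> N v j -> i = j.
  move=> vJ iI jI; rewrite /N; have [->|vi] := eqVneq v i.
    by rewrite (negbTE (indIP i j iI jI)) orbF => _ /eqP.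
  have [->|vj] := eqVneq v j.
    by rewrite /= (negbTE (indIP j i jI iI)).
  move=> /= evi evj; apply/eqP/contraT => ij; exfalso.
  move: vJ; rewrite inE negb_forall_in => /exists_inP[k kI nvk].
  apply: (@P3P1_free_path _ i v j k noP) => //; try exact: indIP.
  by rewrite edge_sym.
have notN v i j : v \notin J -> i \in I -> j \in I -> i != j -> N v i -> ~~ edge j v.
  move=> vJ iI jI ij vi; apply: contraNN ij => jv; apply/eqP.
  by apply: (N_inj v) => //; rewrite /N edge_sym jv orbT.
(* Otherwise [v |: I] would be a larger independent set. *)
have coverI v : exists2 i, i \in I & N v i.
  apply: contrapT => noN; have : independent (v |: I).
    have nv i : i \in I -> ~~ edge v i.
      by move=> iI; apply: contra_notN noN => vi; exists i; rewrite // /N vi orbT.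
    apply/independentP => a b; rewrite !inE.
    case/predU1P=> [->|aI] /predU1P[->|bI]; rewrite ?edge_irrefl //.
    - exact: nv.
    - by rewrite edge_sym nv.
    - exact: indIP.
  move/maxI; rewrite cardsU1; case: (boolP (v \in I)) => [vI|_]; last by rewrite ltnn.
  by case: noN; exists v; rewrite // /N eqxx.
(* The forbidden path is [v], [i], [w], with another element of [I] isolated. *)
have N_clique v w i : v \notin J -> w \notin J -> i \in I -> N v i -> N w i ->
    v != w -> edge v w.
  move=> vJ wJ iI vi wi vw; apply: contraT => nvw; exfalso.
  have [k kI /andP[ki _]] := other i i; rewrite eq_sym in ki.
  have nkv := notN v i k vJ iI kI ki vi; have nkw := notN w i k wJ iI kI ki wi.
  case/orP: (vi) => [/eqP vi'|evi].
    rewrite vi' in vw nvw; case/orP: wi => [|wi].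
      by rewrite eq_sym (negbTE vw).
    by rewrite edge_sym wi in nvw.
  case/orP: (wi) => [/eqP wi'|ewi]; first by rewrite wi' evi in nvw.
  apply: (@P3P1_free_path _ v i w k noP) => //.
  - by rewrite edge_sym.
  - by rewrite edge_sym.
  - exact: indIP.
  - by rewrite edge_sym.
(* The forbidden path is [i], [v], [w], isolated from some [k] in [I] other than [i] and [j]. *)
have N_anticomplete v w i j : v \notin J -> w \notin J -> i \in I -> j \in I ->
    N v i -> N w j -> edge v w -> i = j.
  move=> vJ wJ iI jI vi wj vw; case/orP: (vi) => [/eqP vi'|evi].
    by apply: (N_inj w) => //; rewrite /N edge_sym -vi' vw orbT.
  apply/eqP/contraT => ij; exfalso.
  have [k kI /andP[ki kj]] := other i j; rewrite eq_sym in ki; rewrite eq_sym in kj.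
  have ji : j != i by rewrite eq_sym.
  have niw := notN w j i wJ jI iI ji wj.
  have nkv := notN v i k vJ iI kI ki vi; have nkw := notN w j k wJ jI kI kj wj.
  apply: (@P3P1_free_path _ i v w k noP) => //.
  - apply: contraNneq ij => iw; apply/eqP; case/orP: wj => [/eqP<-//|wj].
    by have := indIP i j iI jI; rewrite iw wj.
  - by rewrite edge_sym.
  - exact: indIP.
  - by rewrite edge_sym.
  - by rewrite edge_sym.
(* With [v] attached to [i], the path [j], [w], [k] through two other elements of [I] would miss
   [v]. *)
have J_complete w v : w \in J -> v \notin J -> edge w v.
  move=> wJ vJ; have [i iI vi] := coverI v; apply: contraT => nwv; exfalso.
  have [j jI /andP[ji _]] := other i i; have [k kI /andP[ki kj]] := other i j.
  rewrite eq_sym in ji; rewrite eq_sym in ki.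
  apply: (@P3P1_free_path _ j w k v noP) => //.
  - by rewrite eq_sym.
  - by rewrite edge_sym JP.
  - exact: JP.
  - exact: indIP.
  - exact: (notN v i).
  - exact: (notN v i).
have szI : (#|I|.-1).+1 = size (enum I) by rewrite -cardE prednK // (leq_trans _ I3).
pose c (t : path_graph (#|I|.-1).+1) := nth x0 (enum I) (t : 'I__).
have cI t : c t \in I by rewrite -mem_enum mem_nth // -szI.
have c_inj : injective c.
  move=> s t /eqP; rewrite nth_uniq ?enum_uniq -?szI //.
  by move/eqP/val_inj.
have c_surj i : i \in I -> exists t, c t = i.
  rewrite -mem_enum => iI; have := iI; rewrite -index_mem -szI => hi.
  by exists (Ordinal hi); apply: nth_index.
pose X t : {set G} := [set v | (v \in J) || N v (c t)].
have XE v t : (v \in X t) = (v \in J) || N v (c t) by rewrite in_set.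
have tdX : is_tree_decomposition X.
  have cover v : exists t, v \in X t.
    have [i iI vi] := coverI v; have [t ct] := c_surj i iI.
    by exists t; rewrite XE ct vi orbT.
  apply: path_decomposition => //.
  - move=> u v uv; have [uJ|uJ] := boolP (u \in J).
      by have [t vt] := cover v; exists t; rewrite vt XE uJ.
    have [vJ|vJ] := boolP (v \in J).
      by have [t ut] := cover u; exists t; rewrite ut XE vJ.
    have [i iI ui] := coverI u; have [j jI vj] := coverI v.
    have eq_ij := N_anticomplete u v i j uJ vJ iI jI ui vj uv.
    have [t ct] := c_surj i iI; exists t.
    by rewrite !XE ct ui eq_ij vj !orbT.
  (* A vertex outside [J] occurs in a single bag, so the order of the bags is arbitrary. *)
  - move=> v i j k ijk; rewrite !XE; have [//|vJ /= vi vk] := boolP (v \in J).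
    have /c_inj ik := N_inj v _ _ vJ (cI i) (cI k) vi vk.
    have -> // : j = i; apply: val_inj => /=.
    by move: ijk; rewrite -ik; lia.
apply: (tree_alpha_le tdX) => t A /subsetP sAX indA.
have indAP := independentP _ indA.
(* Inside [J], the set [A] spans a biclique with [I], which is at least as large. Otherwise [A]
   contains a vertex [v] outside [J], adjacent to all others in the bag, so [A] is a singleton and
   one edge of [G] suffices. *)
have [sAJ|/subsetPn[v vA vJ]] := boolP (A \subset J).
  apply: (@ibn_ge_complete_pair _ A I) => //; last exact: maxI.
  by move=> x y xA yI; apply: JP; rewrite ?(subsetP sAJ).
apply: (@leq_trans 1).
  apply/card_le1P => x xA y; rewrite inE; apply/idP/eqP => [yA|->//].
  have eq_v w : w \in A -> w = v.
    move=> wA; have := indAP w v wA vA; have [wJ|wJ] := boolP (w \in J).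
      by rewrite J_complete.
    move=> nwv; apply/eqP; apply: contraNT nwv => wv.
    have := sAX w wA; have := sAX v vA; rewrite !XE (negbTE vJ) (negbTE wJ) /=.
    by move=> vt wt; apply: (N_clique w v (c t)).
  by rewrite (eq_v x) // (eq_v y).
exact: ibn_gt0 xy0.
Qed.

(** * Induced $C_4$ as a biclique, and the final case distinction *)

(** $C_4$ is $K_{2,2}$, its sides being the diagonal pairs 0, 2 and 1, 3. *)
Lemma ibn_ge2_C4 (G : sgraph) :
  2 <= ibn G <-> has_induced G (cycle_graph 4).
Proof.
split=> [|]; last first.
  case/has_inducedP=> h h_inj hE.
  have pairE (i j : 'I_4) : i != j -> ~~ edge (i : cycle_graph 4) j ->
      independent [set h i; h j] /\ #|[set h i; h j]| = 2.
    move=> ij nij; split; last by rewrite cards2 (inj_eq h_inj) ij.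
    apply/independentP => u v; rewrite !inE.
    case/orP=> /eqP-> /orP[] /eqP->; rewrite ?edge_irrefl ?hE //.
    by rewrite edge_sym.
  have [//|//|ind02 card02] := pairE (inord 0) (inord 2).
  - by rewrite -val_eqE /= !inordK.
  - by rewrite /= -!val_eqE /= !inordK.
  have [//|//|ind13 card13] := pairE (inord 1) (inord 3).
  - by rewrite -val_eqE /= !inordK.
  - by rewrite /= -!val_eqE /= !inordK.
  apply: (ibn_ge_complete_pair ind02 ind13); rewrite ?card02 ?card13 //.
  move=> u v; rewrite !inE.
  by case/orP=> /eqP-> /orP[] /eqP->; rewrite hE /= -!val_eqE /= !inordK.
have /has_inducedP[] := ibn_attained G.
case: (ibn G) => [|[|s]] // h h_inj hE _.
apply: (@has_induced_C4 _ (h (inl ord0)) (h (inr ord0)) (h (inl ord_max)) (h (inr ord_max))).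
all: by rewrite ?hE ?(inj_eq h_inj).
Qed.

Theorem theorem1p9 (G : sgraph)
  (P3P1_free : free (disjoint_union (path_graph 3) (path_graph 1)) G)
  (has_edge : exists x y : G, edge x y) :
  (~ (free (cycle_graph 4) G /\ has_induced G (cycle_graph 5)) ->
     tree_alpha G = ibn G) /\
  (free (cycle_graph 4) G /\ has_induced G (cycle_graph 5) ->
     tree_alpha G = 2).
Proof.
have [x0 [y0 /ibn_gt0 ibn1]] := has_edge.
have lb := tree_alpha_ge_ibn G.
have [I indI maxI] : exists2 I : {set G}, independent I &
    forall A : {set G}, independent A -> #|A| <= #|I|.
  have ind0 : independent (set0 : {set G}) by apply/independentP => x y; rewrite inE.
  by case: (arg_maxnP (fun A : {set G} => #|A|) ind0) => I; exists I.
have [I_le2|I3] := leqP #|I| 2; last first.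
  have ub := alpha3_tree_alpha P3P1_free has_edge indI maxI I3.
  (* The exceptional case is impossible here: an induced $C_5$ forces [ibn G] to be at least 2,
     hence an induced $C_4$. *)
  split=> [_|[noC4 /tree_alpha_ge_C5 ge2]]; first by apply/eqP; rewrite eqn_leq ub.
  by case: noC4; apply/ibn_ge2_C4/(leq_trans ge2).
have alpha2 (A : {set G}) : independent A -> #|A| <= 2.
  by move/maxI/leq_trans; apply.
have le2 : tree_alpha G <= 2.
  by apply: (tree_alpha_le (trivial_td G)) => _ A _; apply: alpha2.
split=> [notC|[_ /tree_alpha_ge_C5 ge2]]; last by apply/eqP; rewrite eqn_leq le2.
apply/eqP; rewrite eqn_leq lb andbT.
(* An induced $C_4$ raises [ibn G] to the bound 2; without one, [notC] also excludes $C_5$ and the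
   chordal case applies. *)
have [/ibn_ge2_C4|noC4] := pselect (has_induced G (cycle_graph 4)).
  exact: leq_trans.
apply: leq_trans ibn1; apply: alpha2_chordal_tree_alpha => // C5.
by apply: notC.
Qed.
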